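(* Let $n\ge 8$. Then the set $\{\eta(\Gamma(G)) : \Gamma(G) \text{ an unbalanced signed graph whose underlying graph } G \text{ is a bicyclic graph on } n \text{ vertices}\}$ equals $\{0,1,2,\ldots,n-4\}$.
   Context: A signed graph $\Gamma(G)=(G,\sigma)$ consists of a simple graph $G$ and a map $\sigma:E(G)\to\{+,-\}$; its adjacency matrix has entry $\sigma(v_iv_j)$ for edges and $0$ otherwise, and $\eta(\Gamma(G))$ is the multiplicity of $0$ as an eigenvalue. A cycle is positive if it has an even number of negative edges; $\Gamma(G)$ is balanced if all its cycles are positive, and unbalanced otherwise. A bicyclic graph is a connected simple graph with $|E|=|V|+1$. *)

(* Defs.v *)
From HB Require Import structures.
From mathcomp Require Import all_boot all_order all_algebra.
Set Implicit Arguments.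
Unset Strict Implicit.
Unset Printing Implicit Defensive.
Import GRing.Theory.
Local Open Scope ring_scope.

Record simple_graph (n : nat) := SimpleGraph {
  edges : {set {set 'I_n}};
  edges_card : forall e : {set 'I_n}, e \in edges -> #|e| = 2%N
}.

Definition adj (n : nat) (G : simple_graph n) : rel 'I_n :=
  fun u v => [set u; v] \in edges G.

Definition connected_graph (n : nat) (G : simple_graph n) : Prop :=
  forall u v : 'I_n, connect (adj G) u v.

Definition bicyclic (n : nat) (G : simple_graph n) : Prop :=
  connected_graph G /\ #|edges G| = n.+1.

(* The sign [true] stands for -, [false] for +, so that (-1) ^+ s is the
   value of the sign s. *)
Record signed_graph (n : nat) := SignedGraph {
  underlying : simple_graph n;
  sigma : {e : {set 'I_n} | e \in edges underlying} -> bool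
}.

(* [Some (sigma uv)] if uv is an edge, [None] otherwise. *)
Definition edge_sign (n : nat) (S : signed_graph n) (u v : 'I_n) :
    option bool :=
  omap (@sigma n S) (insub [set u; v]).

Definition adjacency (R : nzRingType) (n : nat) (S : signed_graph n) :
    'M[R]_n :=
  \matrix_(i, j) (if edge_sign S i j is Some s then (-1) ^+ s else 0).

Definition nullity (R : fieldType) (n : nat) (S : signed_graph n) : nat :=
  mup 0 (char_poly (adjacency R S)).

(* The vertices of [c], in cyclic order, are those of a cycle of the graph;
   the size condition excludes the closed walks [:: u; v] along one edge. *)
Definition is_cycle (n : nat) (G : simple_graph n) (c : seq 'I_n) : Prop :=
  ucycle (adj G) c /\ (2 < size c)%N.

Definition negative_edges (n : nat) (S : signed_graph n) (c : seq 'I_n) : nat :=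
  count (fun u => edge_sign S u (next c u) == Some true) c.

Definition positive_cycle (n : nat) (S : signed_graph n) (c : seq 'I_n) : Prop :=
  ~~ odd (negative_edges S c).

Definition balanced (n : nat) (S : signed_graph n) : Prop :=
  forall c : seq 'I_n, is_cycle (underlying S) c -> positive_cycle S c.

Definition unbalanced (n : nat) (S : signed_graph n) : Prop := ~ balanced S.

(* Main.v *)
(* A is real symmetric, so ker A^2 = ker A and the nullity is n - rank A.

   Rank at least 4.  If u is pendant with neighbor v, some edge wx avoids v
   (a star has fewer than n + 1 edges), and the rows u, w, x, v are triangular
   on the columns v, x, w, u.  Otherwise all degrees are at least 2, with total
   excess 2, so three distinct vertices have degree sum at most 8.  Choosing the
   first two with a common neighbor but distinct neighborhoods, three
   neighborhoods never cover the vertices, so one can greedily choose four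
   rows each of which has a nonzero entry in a column where the previous rows
   vanish.  Signs play no role in this part.

   Every rank r between 4 and n.  A hub 0 carries n + 1 - r pendant vertices
   (pendants at the same vertex give equal rows, so they count once for the
   rank).  Deleting the hub and its pendants leaves a perfect matching (r even)
   or a triangle with a matching (r odd), of nonsingular adjacency matrix, and
   enough edges to the hub make the graph bicyclic, with a negative triangle
   023.  For r = 4 the matching edge is replaced by a path of length 2 whose end
   vertices have equal rows. *)
Require Import Defs.
From mathcomp Require Import all_boot all_order all_algebra.
From mathcomp Require Import zify lra.
Set Implicit Arguments.
Unset Strict Implicit.
Unset Printing Implicit Defensive.
Import Order.TTheory GRing.Theory Num.Theory.

(** * Nullity of a symmetric matrix as its corank *)

Section Nullity.
Local Open Scope ring_scope.

(** The block matrix [K] is made block triangular in two ways by right multiplication. The first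
    gives det K = [char_poly (A *m B)], the second gives det K times ['X^n] = ['X^m] times
    [char_poly (B *m A)]. *)
Lemma char_poly_mulmxC (F : comNzRingType) (m n : nat)
    (A : 'M[F]_(m, n)) (B : 'M[F]_(n, m)) :
  char_poly (A *m B) * 'X^n = char_poly (B *m A) * 'X^m.
Proof.
pose PA := map_mx polyC A; pose PB := map_mx polyC B.
pose K := block_mx 'X%:M PA PB (1%:M : 'M_n).
have K1 : K *m block_mx 1%:M 0 (- PB) 1%:M
        = block_mx (char_poly_mx (A *m B)) PA 0 1%:M.
  rewrite mulmx_block !mulmx1 !mulmx0 !mulmxN mul1mx add0r subrr add0r.
  by rewrite /char_poly_mx map_mxM.
have K2 : K *m block_mx 1%:M (- PA) 0 'X%:M
        = block_mx 'X%:M 0 PB (char_poly_mx (B *m A)).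
  rewrite mulmx_block !mulmx1 !mulmx0 !mulmxN mul1mx !addr0.
  by rewrite scalar_mxC addNr /char_poly_mx map_mxM addrC.
have /(congr1 (@determinant _ _)) := K1.
rewrite det_mulmx det_lblock det_ublock !det1 !mulr1 => D1.
have /(congr1 (@determinant _ _)) := K2.
rewrite det_mulmx det_lblock det_ublock !det1 mul1r !det_scalar D1.
by rewrite [RHS]mulrC.
Qed.

(** If x A A^T = 0, then x A A^T x^T is the sum of the squares of the entries of x A. In an ordered
    field these all vanish, so both matrices have the same left kernel. *)
Lemma mxrank_mul_tr (F : realFieldType) (m n : nat) (A : 'M[F]_(m, n)) :
  \rank (A *m A^T) = \rank A.
Proof.
apply/eqP; rewrite eqn_leq mxrankM_maxl /=.
have /mxrankS : (kermx (A *m A^T) <= kermx A)%MS.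
  apply/row_subP => i; set x := row i _; apply/sub_kermxP.
  have : x *m (A *m A^T) = 0 by apply/sub_kermxP/row_sub.
  move=> /(congr1 (fun y => (y *m x^T) 0 0)).
  rewrite mul0mx mulmxA -mulmxA -trmx_mul mxE [RHS]mxE => sq0.
  have {}sq0 : \sum_k (x *m A) 0 k ^+ 2 = 0.
    by rewrite -[RHS]sq0; apply: eq_bigr => k _; rewrite [_^T _ _]mxE expr2.
  apply/rowP => j; rewrite [RHS]mxE; apply/eqP; rewrite -sqrf_eq0; apply/eqP.
  by apply: (psumr_eq0P _ sq0) => // k _; apply: sqr_ge0.
rewrite !mxrank_ker; have := rank_leq_row A; have := rank_leq_row (A *m A^T).
lia.
Qed.

(** For a full rank factorization A = C B, symmetry makes the r by r matrix B C invertible, so its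
    characteristic polynomial does not vanish at 0. Comparing orders at 0 in [char_poly_mulmxC]
    gives the multiplicity. *)
Lemma mup0_char_poly_sym (F : realFieldType) (n : nat) (A : 'M[F]_n) :
  A^T = A -> mup 0 (char_poly A) = (n - \rank A)%N.
Proof.
move=> symA; set r := \rank A.
pose C := col_base A; pose B := row_base A.
have AE : C *m B = A by apply: mulmx_base.
have rBC : \rank (B *m C) = r.
  (* The rank of A is that of A A = C (B C) B, hence at most that of B C. *)
  apply/eqP; rewrite eqn_leq rank_leq_row /= /r -[leqLHS]mxrank_mul_tr symA.
  rewrite -{1 2}AE mulmxA -(mulmxA C).
  by apply: leq_trans (mxrankM_maxl _ _) (mxrankM_maxr _ _).
have uBC : B *m C \in unitmx by rewrite -row_free_unit /row_free rBC.
have nz (k : nat) (M : 'M[F]_k) : char_poly M != 0.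
  by rewrite monic_neq0 // char_poly_monic.
have nr0 : ~~ root (char_poly (B *m C)) 0.
  rewrite rootE horner_coef0 char_poly_det mulf_eq0 signr_eq0 /=.
  by rewrite -unitfE -unitmxE.
have mX k : mup 0 ('X^k : {poly F}) = k.
  by have := mup_XsubCX k 0 (0 : F); rewrite subr0 eqxx.
have := congr1 (mup 0) (char_poly_mulmxC C B).
rewrite AE (mupMr _ nr0) mupM ?nz ?monic_neq0 ?monicXn // !mX.
exact: (canRL (addnK _)).
Qed.

Lemma mxrank_mxsub (F : fieldType) (m n p q : nat) (A : 'M[F]_(m, n))
    (f : 'I_p -> 'I_m) (g : 'I_q -> 'I_n) :
  (\rank (mxsub f g A) <= \rank A)%N.
Proof.
have rowP' (k l s : nat) (h : 'I_s -> 'I_k) (B : 'M[F]_(k, l)) :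
  (\rank (rowsub h B) <= \rank B)%N by rewrite rowsubE mxrankM_maxr.
have -> : mxsub f g A = rowsub f (rowsub g A^T)^T.
  by apply/matrixP => i j; rewrite !mxE.
by rewrite (leq_trans (rowP' _ _ _ _ _)) // mxrank_tr -(mxrank_tr A).
Qed.

End Nullity.

(** * Ranks of adjacency matrices through triangular submatrices *)

Section Adjacency.
Variables (n : nat) (S : signed_graph n).
Implicit Types u v w x : 'I_n.
Local Notation G := (underlying S).

Lemma adjC u v : adj G u v = adj G v u.
Proof. by rewrite /adj setUC. Qed.

Lemma adj_irrefl u : adj G u u = false.
Proof.
by apply/negP => /(@edges_card _ G); rewrite setUid cards1.
Qed.

Local Open Scope ring_scope.

Lemma adjacency_sym (R : nzRingType) : (adjacency R S)^T = adjacency R S.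
Proof. by apply/matrixP => i j; rewrite !mxE /edge_sign setUC. Qed.

Lemma adjacency_eq0 (R : numDomainType) u v :
  (adjacency R S u v == 0) = ~~ adj G u v.
Proof.
rewrite mxE /edge_sign /adj; case: insubP => [e -> _ | /negPf -> /=].
  by rewrite /= signr_eq0.
by rewrite eqxx.
Qed.

Lemma nullityE (R : realFieldType) :
  nullity R S = (n - \rank (adjacency R S))%N.
Proof. by rewrite /nullity mup0_char_poly_sym // adjacency_sym. Qed.

(** The selected rows and columns form a lower triangular submatrix with nonzero diagonal, which is
    invertible. *)
Lemma rank_adjacency_ge (R : numFieldType) (m : nat) (r c : m.-tuple 'I_n) :
  (forall i, adj G (tnth r i) (tnth c i)) ->
  (forall i j : 'I_m, (i < j)%N -> ~~ adj G (tnth r i) (tnth c j)) ->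
  (m <= \rank (adjacency R S))%N.
Proof.
move=> diag upper; set A := adjacency R S.
pose M := mxsub (tnth r) (tnth c) A.
have trigM : is_trig_mx M.
  apply/is_trig_mxP => i j lt_ij; rewrite mxE; apply/eqP.
  by rewrite adjacency_eq0 upper.
have uM : M \in unitmx.
  rewrite unitmxE (det_trig trigM) unitfE; apply/prodf_neq0 => i _.
  by rewrite mxE adjacency_eq0 diag.
by rewrite -(mxrank_unit uM) mxrank_mxsub.
Qed.

End Adjacency.

(** * Bicyclic graphs on at least 8 vertices have rank at least 4 *)

Section UpperBound.
Variables (n : nat) (S : signed_graph n).
Implicit Types u v w x : 'I_n.
Local Notation G := (underlying S).
Local Notation N := (fun v => [set u | adj G v u]).

(** Double counting of incidences: u is sent to the edge {v, u}, which embeds the neighbors of v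
    into the edges through v. *)
Lemma sum_degree : \sum_v #|N v| <= 2 * #|edges G|.
Proof.
rewrite mulnC -sum_nat_const.
rewrite -(eq_bigr _ (fun e eG => @edges_card n G e eG)).
have -> : \sum_(e in edges G) #|e| = \sum_v #|[set e in edges G | v \in e]|.
  under eq_bigr do rewrite -sum1_card big_mkcond.
  rewrite exchange_big; apply: eq_bigr => v _.
  by rewrite -big_mkcondr -sum1_card; apply: eq_bigl => e; rewrite inE.
apply: leq_sum => v _.
rewrite -(card_in_imset (f := fun u => [set v; u])) => [|u w uN wN eq_uw].
  by apply/subset_leq_card/subsetP => _ /imsetP[u + ->]; rewrite !inE eqxx andbT.
have : u \in [set v; w] by rewrite -eq_uw !inE eqxx orbT.
case/set2P => // uv; move: uN; rewrite inE uv adj_irrefl //.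
Qed.

Lemma neighbor_ex u : connected_graph G -> 1 < n -> exists v, adj G u v.
Proof.
move=> conG n_gt1.
have /card_gt0P[w] : 0 < #|~: [set u]| by rewrite cardsC1 card_ord -subn1 subn_gt0.
rewrite !inE => w_u; case/connectP: (conG u w) => -[|v p] /=.
  by move=> _ wu; rewrite wu eqxx in w_u.
by case/andP=> uv _ _; exists v.
Qed.

(** At most n - 1 edges pass through v, so some edge lies outside this star. *)
Lemma edge_avoiding v : n <= #|edges G| ->
  exists w x, [/\ adj G w x, w != v & x != v].
Proof.
move=> leE; pose star := [set [set v; u] | u in ~: [set v]].
have /subsetPn[e eG e_star] : ~~ (edges G \subset star).
  apply: contraTN leE => /subset_leq_card le_star; rewrite -ltnNge.
  apply: leq_ltn_trans le_star (leq_ltn_trans (leq_imset_card _ _) _).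
  by rewrite cardsC1 card_ord ltn_predL (leq_ltn_trans _ (ltn_ord v)).
have /cards2P[w [x [w_x e_wx]]] : #|e| == 2 by apply/eqP/(edges_card eG).
have wx : adj G w x by rewrite /adj -e_wx.
exists w, x; split=> //; apply: contraNneq e_star => z_v.
  by rewrite e_wx z_v; apply/imsetP; exists x; rewrite // !inE -z_v eq_sym.
by rewrite e_wx z_v setUC; apply/imsetP; exists w; rewrite // !inE -z_v.
Qed.

Variable R : realFieldType.
Local Notation rk := (\rank (adjacency R S)).

Lemma triangular_rank_ge4 (r1 r2 r3 r4 c1 c2 c3 c4 : 'I_n) :
  adj G r1 c1 -> adj G r2 c2 -> adj G r3 c3 -> adj G r4 c4 ->
  ~~ adj G r1 c2 -> ~~ adj G r1 c3 -> ~~ adj G r1 c4 ->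
  ~~ adj G r2 c3 -> ~~ adj G r2 c4 -> ~~ adj G r3 c4 -> 4 <= rk.
Proof.
move=> h1 h2 h3 h4 h12 h13 h14 h23 h24 h34.
apply: (@rank_adjacency_ge _ S R 4 [tuple r1; r2; r3; r4]
  [tuple c1; c2; c3; c4]).
  by case=> [[|[|[|[|k]]]] ltk] //; rewrite !(tnth_nth r1).
case=> [[|[|[|[|k]]]] ltk] [[|[|[|[|l]]]] ltl] //;
  by rewrite !(tnth_nth r1) //.
Qed.

Lemma pendant_rank_ge4 u v : N u = [set v] -> n <= #|edges G| -> 4 <= rk.
Proof.
move=> Nu leE; have [w [x [wx w_v x_v]]] := edge_avoiding v leE.
have xw : adj G x w by rewrite adjC.
have adju y : adj G u y = (y == v) by have /setP/(_ y) := Nu; rewrite !inE.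
apply: (@triangular_rank_ge4 u w x v v x w u);
  by rewrite ?adj_irrefl ?adju ?wx ?xw // adjC adju.
Qed.

(** Each new column [c] is chosen outside the neighborhoods of the rows already taken, and its row
    is any neighbor of [c]. Being adjacent to [c3], the row [v3] differs from [v1] and [v2], so
    [cover3] applies to it. *)
Lemma greedy_rank_ge4 v1 v2 :
    ~~ (N v2 \subset N v1) -> (exists u, adj G v1 u) ->
    (forall w, exists u, adj G w u) ->
    #|N v1 :|: N v2| < n ->
    (forall w, w != v1 -> w != v2 -> #|N v1 :|: N v2 :|: N w| < n) ->
  4 <= rk.
Proof.
move=> /subsetPn[c2]; rewrite !inE => v2c2 v1c2 [c1 v1c1] nbr cover2 cover3.
have ge (A : {set 'I_n}) : #|A| < n -> exists c, c \notin A.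
  move=> ltA; apply/existsP; rewrite -negb_forall; apply: contraTN ltA.
  move=> /forallP fullA; rewrite -leqNgt -{1}(card_ord n).
  by apply/subset_leq_card/subsetP => x _.
have neq (v w c : 'I_n) : ~~ adj G v c -> adj G w c -> w != v.
  by move=> vc; apply: contraTneq => ->.
have [c3] := ge _ cover2; rewrite !inE negb_or => /andP[v1c3 v2c3].
have [v3] := nbr c3; rewrite adjC => v3c3.
have [c4] := ge _ (cover3 v3 (neq _ _ _ v1c3 v3c3) (neq _ _ _ v2c3 v3c3)).
rewrite !inE !negb_or -andbA => /and3P[v1c4 v2c4 v3c4].
have [v4] := nbr c4; rewrite adjC => v4c4.
exact: (triangular_rank_ge4 v1c1 v2c2 v3c3 v4c4).
Qed.

(** The degrees sum to at most 2n + 2, and the vertices outside [D] already use at least 2 each. *)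
Lemma sum_degree_in (D : {set 'I_n}) :
    #|edges G| = n.+1 -> (forall v, 1 < #|N v|) ->
  \sum_(v in D) #|N v| <= 2 * #|D| + 2.
Proof.
move=> cardE deg2; have := sum_degree; rewrite cardE.
rewrite (bigID (mem D)) /=.
have : \sum_(v | v \notin D) 2 <= \sum_(v | v \notin D) #|N v|.
  exact: leq_sum.
rewrite sum_nat_const; have := cardsC D; rewrite card_ord.
have -> : #|[pred v | v \notin D]| = #|~: D|.
  by apply: eq_card => v; rewrite !inE.
move: (\sum_(v in D) _) (\sum_(v | _) _) #|D| #|~: D| => a b c d.
lia.
Qed.

Lemma sum_degree2 u v : #|edges G| = n.+1 -> (forall v, 1 < #|N v|) ->
  u != v -> #|N u| + #|N v| <= 6.
Proof.
move=> cardE deg2 uv; have := sum_degree_in [set u; v] cardE deg2.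
by rewrite big_setU1 ?inE // big_set1 cards2 uv; apply.
Qed.

Lemma sum_degree3 u v w : #|edges G| = n.+1 -> (forall v, 1 < #|N v|) ->
  u != v -> w != u -> w != v -> #|N u| + #|N v| + #|N w| <= 8.
Proof.
move=> cardE deg2 uv wu wv.
have := sum_degree_in (w |: [set u; v]) cardE deg2.
rewrite cardsU1 cards2 !inE negb_or wu wv uv.
rewrite big_setU1 ?inE ?negb_or ?wu // big_setU1 ?inE // big_set1.
by move=> le8; rewrite addnC; apply: le8.
Qed.

(** Otherwise vertices with a common neighbor have equal neighborhoods. For an edge [c0 r0], the
    union of the two neighborhoods is then closed under adjacency, hence contains every vertex by
    connectedness; but it has at most 6 elements by [sum_degree2]. *)
Lemma common_neighbor_distinct : 6 < n -> bicyclic G ->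
    (forall v, 1 < #|N v|) ->
  exists v1 v2 c, [/\ ~~ (N v2 \subset N v1), adj G v1 c & adj G v2 c].
Proof.
move=> n6 [conG cardE] deg2; pose P v1 v2 c :=
  [&& ~~ (N v2 \subset N v1), adj G v1 c & adj G v2 c].
case: (boolP [exists v1, exists v2, exists c, P v1 v2 c]).
  by case/existsP=> v1 /existsP[v2 /existsP[c /and3P[]]]; exists v1, v2, c.
move=> noP; have subN v1 v2 c : adj G v1 c -> adj G v2 c -> N v2 \subset N v1.
  move=> v1c v2c; apply: contraNT noP => nsub.
  apply/existsP; exists v1; apply/existsP; exists v2; apply/existsP; exists c.
  exact/and3P.
have [c0 [r0 c0r0]] : exists c0 r0, adj G c0 r0.
  pose c0 : 'I_n := Ordinal (leq_ltn_trans (leq0n _) n6).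
  by have [|r0] := neighbor_ex c0 conG; [lia | exists c0, r0].
have r0c0 : adj G r0 c0 by rewrite adjC.
pose K := N c0 :|: N r0.
have Kclosed x y : x \in K -> adj G x y -> y \in K.
  rewrite !inE => /orP[] xK xy; apply/orP; [right | left].
    by have /subsetP/(_ y) := subN r0 x c0 r0c0 (etrans (adjC S x c0) xK);
      rewrite !inE; apply.
  by have /subsetP/(_ y) := subN c0 x r0 c0r0 (etrans (adjC S x r0) xK);
    rewrite !inE; apply.
have pathK p x : x \in K -> path (adj G) x p -> last x p \in K.
  by elim: p x => //= z p IHp x xK /andP[/(Kclosed _ _ xK)]; apply: IHp.
have Kfull y : y \in K.
  by have /connectP[p pth ->] := conG r0 y; apply: pathK pth; rewrite !inE c0r0.
have : #|K| = n by rewrite -[RHS]card_ord; apply: eq_card => y; rewrite Kfull.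
have neq : c0 != r0 by apply: contraTneq c0r0 => ->; rewrite adj_irrefl.
have := leq_of_leqif (leq_card_setU (N c0) (N r0)).
move=> /leq_trans/(_ (sum_degree2 cardE deg2 neq)) leK cardK.
by rewrite -cardK ltnNge leK in n6.
Qed.

Lemma bicyclic_rank_ge4 : 7 < n -> bicyclic G -> 4 <= rk.
Proof.
move=> n8 bicG; have [conG cardE] := bicG.
have nbr w : exists u, adj G w u by apply: neighbor_ex conG _; lia.
case: (boolP [forall v, 1 < #|N v|]) => [/forallP deg2|]; last first.
  rewrite negb_forall => /existsP[u]; rewrite -leqNgt => deg1.
  have [v uv] := nbr u.
  apply: (@pendant_rank_ge4 u v); last by rewrite cardE.
  apply/esym/eqP; rewrite eqEcard sub1set inE uv cards1 //.
have [|v1 [v2 [c [nsub v1c v2c]]]] := common_neighbor_distinct _ bicG deg2.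
  exact: leq_trans n8.
have v12 : v1 != v2 by apply: contraNneq nsub => ->.
(* The common neighbor is counted twice, so two neighborhoods cover at most 6 - 1 vertices and three
   cover at most 8 - 1 = 7 < n. *)
have cardI : 0 < #|N v1 :&: N v2| by apply/card_gt0P; exists c; rewrite !inE v1c.
have := cardsUI (N v1) (N v2); have le2 := sum_degree2 cardE deg2 v12.
move=> cardUI; apply: (greedy_rank_ge4 nsub) => //.
- lia.
- move=> w w1 w2; have := sum_degree3 cardE deg2 v12 w1 w2.
  have := leq_of_leqif (leq_card_setU (N v1 :|: N v2) (N w)).
  lia.
Qed.

End UpperBound.

(** * Signed graphs described by relations on natural numbers *)

Section PairGraph.
Variables (n : nat) (e x : rel nat).

(** Each edge is recorded once, as an increasing pair; [d] is read only there, so an asymmetric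
    relation such as parent-child can be used directly. *)
Definition pairs (d : rel nat) :=
  [set q : 'I_n * 'I_n | (q.1 < q.2) && d q.1 q.2].
Definition pair_edges (d : rel nat) := [set [set q.1; q.2] | q in pairs d].

Lemma pair_edges_card d (h : {set 'I_n}) : h \in pair_edges d -> #|h| = 2.
Proof.
case/imsetP => -[i j]; rewrite inE /= => /andP[lt_ij _] ->.
by rewrite cards2 neq_ltn lt_ij.
Qed.

Definition pair_graph := SimpleGraph (@pair_edges_card e).
Definition pair_signed_graph : signed_graph n :=
  @SignedGraph n pair_graph (fun h => val h \in pair_edges x).

Lemma pair_inj (i j k l : 'I_n) :
  i < j -> k < l -> [set i; j] = [set k; l] -> (i, j) = (k, l).
Proof.
move=> ij kl /setP eq_ij; have := eq_ij i; have := eq_ij j.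
rewrite !inE !eqxx orbT /=.
case/esym/orP=> /eqP jE /esym/orP[] /eqP iE; subst => //.
- by rewrite ltnn in ij.
- by have := ltn_trans ij kl; rewrite ltnn.
- by rewrite ltnn in ij.
Qed.

Lemma mem_pair_edges d (i j : 'I_n) :
  i < j -> ([set i; j] \in pair_edges d) = d i j.
Proof.
move=> ij; apply/imsetP/idP => [[[k l]] | dij]; last first.
  by exists (i, j); rewrite // inE /= ij.
by rewrite inE /= => /andP[kl dkl] /(pair_inj ij kl)[-> ->].
Qed.

Lemma card_pair_edges d : #|pair_edges d| = #|pairs d|.
Proof.
apply: card_in_imset => -[i j] [k l]; rewrite !inE /=.
by move=> /andP[ij _] /andP[kl _]; apply: pair_inj.
Qed.

Local Open Scope ring_scope.

(** The adjacency entries, indexed by natural numbers so that entries at numerals compute without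
    ordinals. *)
Definition weight (R : nzRingType) (i j : nat) : R :=
  let f i j := if e i j then (-1) ^+ x i j else 0 in
  if (i < j)%N then f i j else if (j < i)%N then f j i else 0.

Lemma pair_edge_sign (i j : 'I_n) : (i < j)%N ->
  edge_sign pair_signed_graph i j = if e i j then Some (x i j) else None.
Proof.
move=> ij; rewrite /edge_sign; case: insubP => [h | /negPf] /=.
  rewrite mem_pair_edges // => -> hE /=; rewrite hE mem_pair_edges //.
by rewrite mem_pair_edges // => ->.
Qed.

Lemma adjacency_pair (R : nzRingType) (i j : 'I_n) :
  adjacency R pair_signed_graph i j = weight R i j.
Proof.
rewrite mxE /weight; case: ltngtP => [ij|ij|/val_inj ->].
- by rewrite pair_edge_sign //; case: ifP.
- by rewrite /edge_sign setUC -/(edge_sign _ _ _) pair_edge_sign //; case: ifP.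
- rewrite /edge_sign setUid insubN //; apply/negP => /pair_edges_card.
  by rewrite cards1.
Qed.

End PairGraph.

(* A spanning tree rooted at 0, given by the parent function [p], plus the two
   negative edges 03 and ab. *)
Section Tree.
Variables (m : nat) (p : nat -> nat) (a b : nat).
Local Notation n := m.+1.
Hypothesis p_lt : forall j, 0 < j -> p j < j.
Hypotheses (n_gt3 : 3 < n) (b_lt : b < n) (ab : a < b).
Hypotheses (p2 : p 2 = 0) (p3 : p 3 = 2) (pb : p b != a) (ab03 : (a, b) != (0, 3)).

Definition extra (i j : nat) := ((i, j) == (0, 3)) || ((i, j) == (a, b)).
Definition tree_edge (i j : nat) := (i == p j) || extra i j.
Definition tree_graph := pair_signed_graph n tree_edge extra.

(** Parents decrease, so strong induction climbs from any vertex to the root. *)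
Lemma tree_graph_connected : connected_graph (underlying tree_graph).
Proof.
have symc : connect_sym (adj (underlying tree_graph)).
  by apply: sym_connect_sym => u v; apply: adjC.
suff to0 i : connect (adj (underlying tree_graph)) (ord0 : 'I_n) i.
  by move=> u v; apply: connect_trans (to0 v); rewrite symc.
have [k] := ubnP (i : nat); elim: k i => // k IHk i; rewrite ltnS => ik.
have [/eqP i0|i_gt0] := posnP i.
  by rewrite (_ : i = ord0) ?connect0 //; apply/val_inj/eqP.
have pi := p_lt i_gt0; have pin := ltn_trans pi (ltn_ord i).
apply: connect_trans (IHk (Ordinal pin) (leq_trans pi ik)) (connect1 _).
by rewrite /adj mem_pair_edges //= /tree_edge eqxx.
Qed.

(** The n - 1 tree edges are indexed by their child. The two extra edges are distinct and off the
    tree, because [p 3 = 2] and [p b != a]. *)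
Lemma tree_graph_card : #|edges (underlying tree_graph)| = n.+1.
Proof.
rewrite card_pair_edges.
have -> : pairs n tree_edge = (inord 0, inord 3) |: ((inord a, inord b) |:
    [set (inord (p j) : 'I_n, j) | j : 'I_n in [set~ ord0]]).
  apply/setP => -[i j]; rewrite !inE /= /tree_edge /extra.
  rewrite !xpair_eqE -!val_eqE /= !inordK //; last exact: ltn_trans b_lt.
  have -> : ((i, j) \in [set (inord (p j) : 'I_n, j) | j : 'I_n in [set~ ord0]])
      = (i < j) && (i == p j :> nat).
    apply/imsetP/andP => [[k + [-> ->]] | [ij /eqP ip]].
      rewrite !inE -val_eqE /= -lt0n => k_gt0; have pk := p_lt k_gt0.
      by rewrite inordK // (ltn_trans pk).
    exists j; first by rewrite !inE -val_eqE /= -lt0n (leq_ltn_trans _ ij).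
    by rewrite -ip inord_val.
  case: (ltnP i j) => [_ | ji] /=; first by rewrite orbC -orbA.
  by apply/esym/negbTE/norP; split; apply/negP => /andP[/eqP ? /eqP ?]; lia.
rewrite !cardsU1 card_in_imset; last by move=> i j _ _ [_ ->].
rewrite cardsC1 card_ord /= !inE.
have nmem i j : i < n -> j < n -> 0 < j -> p j != i ->
    (inord i, inord j) \notin [set (inord (p j) : 'I_n, j) | j : 'I_n in [set~ ord0]].
  move=> ltin ltjn j_gt0 pji; apply/imsetP => -[k _ [+ jk]].
  rewrite -jk => /(congr1 (@nat_of_ord n)).
  rewrite !inordK //; last by rewrite (ltn_trans (p_lt j_gt0)).
  by move=> ip; rewrite ip eqxx in pji.
have a_lt := ltn_trans ab b_lt; have b_gt0 := leq_ltn_trans (leq0n a) ab.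
rewrite negb_or !nmem ?p3 // andbT.
have -> // : (inord 0, inord 3) != (inord a, inord b) :> 'I_n * 'I_n.
apply: contraNneq ab03 => -[/(congr1 (@nat_of_ord n)) + /(congr1 (@nat_of_ord n))].
by rewrite !inordK // => <- <-.
Qed.

Lemma tree_graph_bicyclic : bicyclic (underlying tree_graph).
Proof. by split; [exact: tree_graph_connected|exact: tree_graph_card]. Qed.

Lemma tree_graph_unbalanced : unbalanced tree_graph.
Proof.
have lt0 : 0 < n by []. have lt2 : 2 < n by apply: ltn_trans n_gt3.
pose v0 := Ordinal lt0; pose v2 := Ordinal lt2; pose v3 := Ordinal n_gt3.
have e02 : edge_sign tree_graph v0 v2 = Some (extra 0 2).
  by rewrite pair_edge_sign //= /tree_edge p2.
have e23 : edge_sign tree_graph v2 v3 = Some (extra 2 3).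
  by rewrite pair_edge_sign //= /tree_edge p3.
have e03 : edge_sign tree_graph v0 v3 = Some true.
  by rewrite pair_edge_sign //= /tree_edge /extra eqxx orbT.
have adjE u v : (edge_sign tree_graph u v != None) = adj (underlying tree_graph) u v.
  by rewrite /edge_sign /adj; case: insubP => [h -> | /negPf ->].
have e30 : edge_sign tree_graph v3 v0 = Some true.
  by rewrite -e03 /edge_sign setUC.
(* A tree edge is never ab, since [p b != a]. Hence 02 and 23 are positive, and 03 is the only
   negative edge of the triangle 023. *)
have pos i j : i = p j -> (i, j) != (0, 3) -> extra i j = false.
  move=> ip; rewrite /extra => /negPf ->; apply/negP => /eqP[ia jb].
  by move: pb; rewrite -ia ip -jb eqxx.
rewrite pos ?p2 // in e02; rewrite pos ?p3 // in e23.
move=> /(_ [:: v0; v2; v3]); rewrite /is_cycle /positive_cycle /negative_edges.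
rewrite /ucycle /= -!adjE e02 e23 e30 /=.
by move=> /(_ (conj isT isT)).
Qed.
End Tree.

(** * Exact rank from repeated rows and a nonsingular leading block *)

Section WeightRank.
Local Open Scope ring_scope.

(** Every row repeats one of the first r rows, which bounds the rank by r; the last hypothesis says
    that the leading r by r block has trivial left kernel. *)
Lemma mxrank_twins (F : fieldType) (n r : nat) (w : nat -> nat -> F)
    (f : nat -> nat) : (r <= n)%N ->
    (forall i, (i < n)%N -> (f i < r)%N) ->
    (forall i j, (i < n)%N -> w i j = w (f i) j) ->
    (forall x : nat -> F,
       (forall j, (j < r)%N -> \sum_(i < r) x i * w i j = 0) ->
       forall i, (i < r)%N -> x i = 0) ->
  \rank (\matrix_(i < n, j < n) w i j) = r.
Proof.
move=> le_rn f_lt twin inj; set A := \matrix_(i, j) _.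
pose iota := widen_ord le_rn.
apply/eqP; rewrite eqn_leq; apply/andP; split.
  pose phi (i : 'I_n) := Ordinal (f_lt i (ltn_ord i)).
  have -> : A = rowsub phi (rowsub iota A).
    by apply/matrixP => i j; rewrite !mxE /= -twin.
  by rewrite rowsubE (leq_trans (mxrankM_maxr _ _)) // rank_leq_row.
suff /eqP <- : row_free (mxsub iota iota A) by apply: mxrank_mxsub.
apply: inj_row_free => v vA0.
pose x k := if insub k is Some i then v 0 (i : 'I_r) else 0.
have xE (i : 'I_r) : x i = v 0 i by rewrite /x valK.
apply/rowP => i; rewrite mxE -xE; apply: inj => // j ltj.
have := congr1 (fun u : 'rV_r => u 0 (Ordinal ltj)) vA0.
rewrite !mxE => sum0; rewrite -[RHS]sum0.
by apply: eq_bigr => k _; rewrite xE !mxE.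
Qed.

Definition linked (e : rel nat) (i j : nat) : bool :=
  (i < j)%N && e i j || (j < i)%N && e j i.

Lemma linkedC e i j : linked e i j = linked e j i.
Proof. by rewrite /linked orbC. Qed.

Lemma weight_eq0 (R : numDomainType) (e x : rel nat) (i j : nat) :
  (weight e x R i j == 0) = ~~ linked e i j.
Proof.
rewrite /weight /linked; case: ltngtP => _ /=; rewrite ?orbF ?eqxx //;
  by case: (e _ _); rewrite ?signr_eq0 ?eqxx.
Qed.

Section Kernel.
Variables (F : numFieldType) (e sg : rel nat) (r : nat) (x : nat -> F).
Hypothesis eqs : forall j, (j < r)%N -> \sum_(i < r) x i * weight e sg F i j = 0.

(** The elimination step: if [k] is the only neighbor of [j] whose coordinate may be nonzero, the
    equation at [j] kills it. *)
Lemma kernel_coord0 (j k : nat) :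
    (j < r)%N -> (k < r)%N -> linked e j k ->
    (forall i, (i < r)%N -> i != k -> x i != 0 -> ~~ linked e i j) ->
  x k = 0.
Proof.
move=> ltj ltk jk rest; have := eqs ltj; rewrite (bigD1 (Ordinal ltk)) //=.
rewrite big1 ?addr0 => [/eqP|i ik].
  by rewrite mulf_eq0 weight_eq0 linkedC jk orbF => /eqP.
apply/eqP; rewrite mulf_eq0 weight_eq0 -implyNb; apply/implyP.
exact: rest (ltn_ord i) ik.
Qed.

Lemma kernel_coord2 (j k l : nat) :
    (j < r)%N -> (k < r)%N -> (l < r)%N -> k != l ->
    (forall i, (i < r)%N -> i != k -> i != l -> x i != 0 -> ~~ linked e i j) ->
  x k * weight e sg F k j + x l * weight e sg F l j = 0.
Proof.
move=> ltj ltk ltl kl rest; have := eqs ltj.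
rewrite (bigD1 (Ordinal ltk)) // (bigD1 (Ordinal ltl)) /= 1?eq_sym //.
rewrite big1 ?addr0 // => i /andP[ik il].
apply/eqP; rewrite mulf_eq0 weight_eq0 -implyNb; apply/implyP.
exact: rest (ltn_ord i) ik il.
Qed.

End Kernel.

(** The row of a positive pendant at the hub is the unit vector at 0, so all such vertices are
    twins. *)
Lemma weight_pendant (R : nzRingType) (p : nat -> nat) (a b i j : nat) :
    (0 < i)%N -> p i = 0%N -> (forall k, extra a b k i = false) ->
    (forall k, (i < k)%N -> tree_edge p a b i k = false) ->
  weight (tree_edge p a b) (extra a b) R i j = (j == 0%N)%:R.
Proof.
move=> i_gt0 pi_0 noextra nochild; rewrite /weight; case: ltngtP => [ij|ji|<-].
- by rewrite nochild //; case: j ij.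
- by rewrite {1}/tree_edge noextra orbF pi_0; case: eqP.
- by case: (i) i_gt0.
Qed.

(** * Nonsingularity of the leading blocks of the two families *)

Section Families.
Variables (F : realFieldType) (r : nat) (p : nat -> nat) (a b : nat).
Variable x : nat -> F.
Local Notation e := (tree_edge p a b).
Hypothesis eqs : forall j, (j < r)%N ->
  \sum_(i < r) x i * weight e (extra a b) F i j = 0.

(* The matching is {2,3}, {4,5}, ..., and the children of the hub are 1 and the
   even vertices. *)
Definition matching_parent (i : nat) : nat :=
  if (2 < i)%N && odd i then i.-1 else 0.

(** The equation at the pendant 1 kills [x 0], the one at the partner of [i] kills [x i], and the
    one at 0 finally kills [x 1]. When r = 4 and b = 4, the edge ab lies outside the block. *)
Lemma matching_kernel :
    (3 < r)%N -> ~~ odd r -> (forall i, (i < r)%N -> p i = matching_parent i) ->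
    a = 0%N -> (b == 5) || (r == 4) && (b == 4) ->
  forall i, (i < r)%N -> x i = 0.
Proof.
move=> r_gt3 even_r pE a0 bE.
(* An arithmetic form of the edges inside the block, decidable by [lia]. *)
pose nb i j := [|| [&& odd j, 2 < j & i.+1 == j],
  ~~ (odd j && (2 < j)) && (i == 0), (i == 0) && (j == 3) | (i == 0) && (j == b)]%N.
have linkE i j : (i < r)%N -> (j < r)%N -> linked e i j = linked nb i j.
  have edgeE k l : (l < r)%N -> (k < l)%N && e k l = (k < l)%N && nb k l.
    move=> ltl; case: (ltnP k l) => //= kl.
    rewrite /tree_edge /extra !xpair_eqE pE // a0 /nb /matching_parent.
    case: ifP; lia.
  by move=> lti ltj; rewrite /linked !edgeE.
have x0 : x 0%N = 0.
  by apply: (kernel_coord0 eqs (j := 1)) => [|||i lti i0 _];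
    rewrite ?linkE /linked /nb; lia.
have xrest i : (1 < i)%N -> (i < r)%N -> x i = 0.
  move=> i_gt1 lti; pose j := if odd i then i.-1 else i.+1.
  have ltj : (j < r)%N by rewrite /j; case: ifP; lia.
  apply: (kernel_coord0 eqs (j := j)) => //.
    by rewrite linkE // /linked /nb /j; case: ifP; lia.
  move=> k ltk ki xk0; have k0 : k != 0%N by apply: contraNneq xk0 => ->; apply/eqP.
  by rewrite linkE // /linked /nb /j; case: ifP; lia.
have x1 : x 1%N = 0.
  apply: (kernel_coord0 eqs (j := 0)); [lia|lia|by rewrite linkE /linked /nb; lia|].
  move=> i lti i1; have [i_gt1|] := ltnP 1 i; first by rewrite xrest ?eqxx.
  by rewrite leq_eqVlt (negPf i1) ltnS leqn0 => /eqP ->; rewrite x0 eqxx.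
by case=> [|[|i]] // lti; apply: xrest.
Qed.

(* The triangle is {2,3,4}, closed by the extra edge 34, and the matching is
   {5,6}, {7,8}, ... *)
Definition triangle_parent (i : nat) : nat :=
  if (i == 3) || (i == 4) then 2 else if (4 < i)%N && ~~ odd i then i.-1 else 0.

(** Elimination runs as for the matching, except on the triangle. There, with 34 negative, the
    equations read x3 + x4 = 0, x2 = x4 and x2 = x3, which force all three to vanish. *)
Lemma triangle_kernel :
    (4 < r)%N -> odd r -> (forall i, (i < r)%N -> p i = triangle_parent i) ->
    a = 3 -> b = 4 ->
  forall i, (i < r)%N -> x i = 0.
Proof.
move=> r_gt4 odd_r pE a3 b4.
pose nb i j := [|| ((j == 3) || (j == 4)) && (i == 2),
  [&& ~~ odd j, 4 < j & i.+1 == j],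
  [&& j != 3, j != 4, odd j || (j <= 4) & i == 0],
  (i == 0) && (j == 3) | (i == 3) && (j == 4)]%N.
have linkE i j : (i < r)%N -> (j < r)%N -> linked e i j = linked nb i j.
  have edgeE k l : (l < r)%N -> (k < l)%N && e k l = (k < l)%N && nb k l.
    move=> ltl; case: (ltnP k l) => //= kl.
    rewrite /tree_edge /extra !xpair_eqE pE // a3 b4 /nb /triangle_parent.
    case: ifP; [lia | case: ifP; lia].
  by move=> lti ltj; rewrite /linked !edgeE.
have x0 : x 0%N = 0.
  by apply: (kernel_coord0 eqs (j := 1)) => [|||i lti i0 _];
    rewrite ?linkE /linked /nb; lia.
have nz k : x k != 0 -> k != 0%N by apply: contraNneq => ->; apply/eqP.
have xrest i : (4 < i)%N -> (i < r)%N -> x i = 0.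
  move=> i_gt4 lti; pose j := if odd i then i.+1 else i.-1.
  have ltj : (j < r)%N by rewrite /j; case: ifP; lia.
  apply: (kernel_coord0 eqs (j := j)) => //.
    by rewrite linkE // /linked /nb /j; case: ifP; lia.
  move=> k ltk ki /nz k0.
  by rewrite linkE // /linked /nb /j; case: ifP; lia.
have [lt2 lt3] : (2 < r)%N /\ (3 < r)%N by lia.
have E2 : x 3 * weight e (extra a b) F 3 2 + x 4 * weight e (extra a b) F 4 2 = 0.
  apply: (kernel_coord2 eqs) => // i lti i3 i4 /nz i0; rewrite linkE // /linked /nb; lia.
have E3 : x 2 * weight e (extra a b) F 2 3 + x 4 * weight e (extra a b) F 4 3 = 0.
  apply: (kernel_coord2 eqs) => // i lti i3 i4 /nz i0; rewrite linkE // /linked /nb; lia.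
have E4 : x 2 * weight e (extra a b) F 2 4 + x 3 * weight e (extra a b) F 3 4 = 0.
  apply: (kernel_coord2 eqs) => // i lti i3 i4 /nz i0; rewrite linkE // /linked /nb; lia.
move: E2 E3 E4; rewrite /weight /tree_edge /extra a3 b4 !pE //= => E2 E3 E4.
have x2 : x 2 = 0 by lra.
have x3 : x 3 = 0 by lra.
have x4 : x 4 = 0 by lra.
have x1 : x 1%N = 0.
  apply: (kernel_coord0 eqs (j := 0)); [lia|lia|by rewrite linkE /linked /nb; lia|].
  move=> i lti i1 xi0 ; suff : x i = 0 by move/eqP; rewrite (negPf xi0).
  by case: i lti i1 {xi0} => [|[|[|[|[|i]]]]] // lti _; apply: xrest.
by case=> [|[|[|[|[|i]]]]] // lti; apply: xrest.
Qed.

End Families.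
End WeightRank.

(** * Realizing every rank from 4 to n *)

Section Realization.
Variables (F : realFieldType) (m r : nat).
Local Notation n := m.+1.

Lemma tree_graph_realizes (p : nat -> nat) (a b : nat) (f : nat -> nat) :
    let e := tree_edge p a b in let sg := extra a b in
    7 < n -> r <= n -> (forall j, 0 < j -> p j < j) -> a < b -> b < n ->
    p 2 = 0 -> p 3 = 2 -> p b != a -> (a, b) != (0, 3) ->
    (forall i, i < n -> f i < r) ->
    (forall i j, i < n -> weight e sg F i j = weight e sg F (f i) j) ->
    (forall x : nat -> F,
      (forall j, j < r -> (\sum_(i < r) x i * weight e sg F i j = 0)%R) ->
      forall i, i < r -> x i = 0%R) ->
  exists S : signed_graph n,
    bicyclic (underlying S) /\ unbalanced S /\ nullity F S = n - r.
Proof.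
move=> e sg n8 rn p_lt ab b_lt p2 p3 pb ab03 f_lt twin inj.
exists (tree_graph m p a b); have n_gt3 : 3 < n by lia.
split; first exact: tree_graph_bicyclic.
split; first exact: tree_graph_unbalanced.
rewrite nullityE -(mxrank_twins rn f_lt twin inj); congr (_ - \rank _).
by apply/matrixP => i j; rewrite adjacency_pair mxE.
Qed.

Lemma rank_realizable : 7 < n -> 3 < r -> r <= n ->
  exists S : signed_graph n,
    bicyclic (underlying S) /\ unbalanced S /\ nullity F S = n - r.
Proof.
move=> n8 r_gt3 rn.
case: (boolP (odd r)) => [odd_r | even_r].
- have r_gt4 : 4 < r by rewrite ltn_neqAle r_gt3 andbT; apply: contraTneq odd_r => <-.
  (* The vertices from r on hang at the hub; the map [f] below sends them to their twin 1, the
     pendant inside the block. *)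
  pose p i := if i < r then triangle_parent i else 0.
  have p_lt j : 0 < j -> p j < j.
    by rewrite /p /triangle_parent; do !case: ifP; lia.
  have pE i : i < r -> p i = triangle_parent i by rewrite /p => ->.
  pose f i := if i < r then i else 1.
  apply: (tree_graph_realizes (p := p) (a := 3) (b := 4) (f := f)) => //.
  + lia.
  + by rewrite pE //; lia.
  + by rewrite pE //; lia.
  + by rewrite pE.
  + by move=> i _; rewrite /f; case: ifP; lia.
  + move=> i j _; rewrite /f; case: ifP => // ir.
    have pendant k : 0 < k -> (k == 1) || (r <= k) ->
        weight (tree_edge p 3 4) (extra 3 4) F k j = ((j == 0)%:R)%R.
      move=> k_gt0 kr; apply: weight_pendant => // [|l|l kl].
      - by rewrite /p /triangle_parent; do ?case: ifP; lia.
      - by rewrite /extra !xpair_eqE; lia.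
      - by rewrite /tree_edge /extra !xpair_eqE /p /triangle_parent; do ?case: ifP; lia.
    by rewrite !pendant //; lia.
  + by move=> x eqs; apply: (triangle_kernel eqs).
case: (eqVneq r 4) => [r4 | r_neq4].
- pose p i := if (i == 3) || (i == 4) then 2 else 0.
  have p_lt j : 0 < j -> p j < j by rewrite /p; case: ifP; lia.
  (* Vertices 3 and 4 both have a positive edge to 2 and a negative edge to 0, so their rows agree;
     later vertices are twins of 1. *)
  pose f i := if i < 4 then i else if i == 4 then 3 else 1.
  apply: (tree_graph_realizes (p := p) (a := 0) (b := 4) (f := f)) => //.
  + lia.
  + by move=> i _; rewrite /f r4; do !case: ifP; lia.
  + move=> i j _; rewrite /f; case: ifP => // i4; case: eqP => [-> | i_neq4].
      by case: j => [|[|[|[|[|j]]]]].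
    have pendant k : 0 < k -> (k == 1) || (4 < k) ->
        weight (tree_edge p 0 4) (extra 0 4) F k j = ((j == 0)%:R)%R.
      move=> k_gt0 kr; apply: weight_pendant => // [|l|l kl].
      - by rewrite /p; do ?case: ifP; lia.
      - by rewrite /extra !xpair_eqE; lia.
      - by rewrite /tree_edge /extra !xpair_eqE /p; do ?case: ifP; lia.
    by rewrite !pendant //; lia.
  + move=> x eqs; apply: (matching_kernel eqs) => //; last by rewrite r4.
    by move=> i; rewrite r4; case: i => [|[|[|[|i]]]].
(* From r = 6 on, the matching edge 45 lies in the block, and the second extra edge 05 closes the
   triangle 045. *)
have r_gt5 : 5 < r by move: even_r r_neq4; case: (r) r_gt3 => [|[|[|[|[|[|k]]]]]].
pose p i := if i < r then matching_parent i else 0.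
have p_lt j : 0 < j -> p j < j.
  by rewrite /p /matching_parent; do !case: ifP; lia.
have pE i : i < r -> p i = matching_parent i by rewrite /p => ->.
pose f i := if i < r then i else 1.
apply: (tree_graph_realizes (p := p) (a := 0) (b := 5) (f := f)) => //.
+ lia.
+ by rewrite pE //; lia.
+ by rewrite pE //; lia.
+ by rewrite pE.
+ by move=> i _; rewrite /f; case: ifP; lia.
+ move=> i j _; rewrite /f; case: ifP => // ir.
  have pendant k : 0 < k -> (k == 1) || (r <= k) ->
      weight (tree_edge p 0 5) (extra 0 5) F k j = ((j == 0)%:R)%R.
    move=> k_gt0 kr; apply: weight_pendant => // [|l|l kl].
    - by rewrite /p /matching_parent; do ?case: ifP; lia.
    - by rewrite /extra !xpair_eqE; lia.
    - by rewrite /tree_edge /extra !xpair_eqE /p /matching_parent; do ?case: ifP; lia.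
  by rewrite !pendant //; lia.
+ by move=> x eqs; apply: (matching_kernel eqs).
Qed.

End Realization.

Theorem theorem5p8 (R : realFieldType) (n : nat) (hn : (8 <= n)%N) :
  forall k : nat,
    (exists S : signed_graph n,
       bicyclic (underlying S) /\ unbalanced S /\ nullity R S = k)
    <-> (k <= n - 4)%N.
Proof.
move=> k; split=> [[S [bicS [_ <-]]] | le_k].
  by rewrite nullityE leq_sub2l // bicyclic_rank_ge4.
case: n hn le_k => // m hn le_k.
(* Nullity [k] calls for rank n - k, which lies between 4 and n. *)
have [] := @rank_realizable R m (m.+1 - k) hn; [lia|lia|].
by move=> S HS; exists S; rewrite (_ : k = m.+1 - (m.+1 - k)) //; lia.
Qed.
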